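(* Let $c>0$. For every $c$-expensive mechanism $M$ and every distribution $\mathcal{D}$ over $\mathbb{R}^k_{\ge0}$, there exists a $c$-expensive mechanism $M'$ which is either oddly-priced or evenly-priced and satisfies $\mathrm{Rev}(\mathcal{D},M')\ge \mathrm{Rev}(\mathcal{D},M)/2$.
   Context: Setting: one seller, one additive buyer, $k$ items; the buyer's value vector $\vec v\in\mathbb{R}^k_{\ge0}$ is drawn from a distribution $\mathcal{D}$. A mechanism $M$ is a set of options $(\vec q,p)$ with $\vec q\in[0,1]^k$, $p\in\mathbb{R}$, always containing the null option $(\vec 0,0)$; a buyer with values $\vec v$ selects an option maximizing $\vec v\cdot\vec q-p$ (ties broken arbitrarily; a maximizer is assumed to exist), and $\vec q^M(\vec v),p^M(\vec v)$ denote the allocation and price of the selected option. $\mathrm{Rev}(\mathcal{D},M)=\mathbb{E}_{\vec v\sim\mathcal{D}}[p^M(\vec v)]$. A mechanism is $c$-expensive if every option other than the null option has price at least $c$. A $c$-expensive mechanism is oddly-priced (resp. evenly-priced) if every option other than the null option has price in $[c\cdot2^i,c\cdot 2^{i+1})$ for some odd (resp. even) integer $i$. *)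

(* Defs.v *)
From HB Require Import structures.
From mathcomp Require Import all_boot all_order all_algebra.
From mathcomp Require Import all_classical all_reals all_analysis.
Set Implicit Arguments. Unset Strict Implicit. Unset Printing Implicit Defensive.
Import Order.TTheory GRing.Theory Num.Theory.
Local Open Scope classical_set_scope.
Local Open Scope ring_scope.

Section Mech.
Variables (R : realType) (k : nat).

Definition vec := k.-tuple R.
Definition opt := (vec * R)%type.

Definition dot (v q : vec) : R := \sum_(i < k) tnth v i * tnth q i.

Definition null_opt : opt := ([tuple of nseq k 0], 0).

Definition nonneg_vec (v : vec) : Prop := forall i, 0 <= tnth v i.

Definition util (v : vec) (o : opt) : R := dot v o.1 - o.2.

Definition mechanism (M : set opt) : Prop :=
  M null_opt /\ (forall o, M o -> forall i, 0 <= tnth o.1 i <= 1).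

(* sel is a (tie-breaking) selection rule for M: for every buyer type
   v >= 0 it picks a utility-maximizing option of M *)
Definition selection (M : set opt) (sel : vec -> opt) : Prop :=
  forall v, nonneg_vec v ->
    M (sel v) /\ (forall o, M o -> util v o <= util v (sel v)).

Definition expensive (c : R) (M : set opt) : Prop :=
  forall o, M o -> o <> null_opt -> c <= o.2.

Definition oddly_priced (c : R) (M : set opt) : Prop :=
  forall o, M o -> o <> null_opt ->
    exists i : int, odd `|i|%N /\ c * 2 ^ i <= o.2 < c * 2 ^ (i + 1).

Definition evenly_priced (c : R) (M : set opt) : Prop :=
  forall o, M o -> o <> null_opt ->
    exists i : int, ~~ odd `|i|%N /\ c * 2 ^ i <= o.2 < c * 2 ^ (i + 1).

(* Rev(D, M) = E_{v ~ D}[p^M(v)] where p^M(v) is the price of the option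
   selected by the selection rule *)
Definition Rev (D : probability vec R) (sel : vec -> opt) : \bar R :=
  (\int[D]_v ((sel v).2)%:E)%E.

End Mech.

(* Main.v *)
Require Import Defs.
From HB Require Import structures.
From mathcomp Require Import all_boot all_order all_algebra.
From mathcomp Require Import all_classical all_reals all_analysis.
From mathcomp Require Import measurable_realfun ring lra.
Import Order.TTheory GRing.Theory Num.Theory.
Import numFieldNormedType.Exports.
Local Open Scope classical_set_scope.
Local Open Scope ring_scope.

(** Splitting the options of M by the parity of their price bin
    [c 2^n, c 2^(n+1)[ keeps the total revenue, because a buyer whose option
    survives still selects it. The difficulty is that the two parts need not
    have utility maximizers: prices may accumulate at the top of a bin, which
    has the wrong parity. So the bins are truncated to [c 2^n, t_n] with
    t_n < c 2^(n+1) so close to the top that the buyers lost this way bring an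
    arbitrarily small revenue. Each part is then enlarged to all the options of
    admissible price that nobody strictly prefers to their choice in M; this set
    is compact in each bin, so maximizers exist, and resolving ties towards the
    highest price gives a measurable selection.

    The arbitrarily small loss is absorbed as follows. The option (q, p) of a
    buyer can be scaled down to (c q / p, c), which lies in the even bin 0, and
    whose utility is nonnegative and at most that of (q, p). Hence the even menu
    collects at least c from every buyer of M, including the odd ones, and the
    revenues of the two menus add up to Rev(M) + c P(odd buyers) minus the loss.
    If odd buyers have probability 0, the even menu alone is enough. *)

Set Implicit Arguments.
Unset Strict Implicit.

(** * Utility as a function of the buyer and of the option *)

Section Utility.
Variables (R : realType) (k : nat).
Implicit Types (v q : vec R k) (o : opt R k).

Lemma measurable_util o : measurable_fun [set: vec R k] (fun v => util v o).
Proof.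
apply: measurable_funB => //; apply: measurable_sum => i.
by apply: measurable_funM => //; exact: measurable_tnth.
Qed.

Lemma measurable_nonneg_vec : measurable [set v : vec R k | nonneg_vec v].
Proof.
rewrite (_ : [set v | _] =
    \bigcap_(i in [set: 'I_k]) ((fun v : vec R k => tnth v i) @^-1` `[0, +oo[)).
  apply: fin_bigcap_measurable => // i _; rewrite -[X in measurable X]setTI.
  by apply: (@measurable_tnth _ _ k i) => //; exact: measurable_itv.
by apply/seteqP; split => v /= h i; have := h i; rewrite /= in_itv/= andbT //;
  apply.
Qed.

Lemma util_null v : util v (null_opt R k) = 0.
Proof.
rewrite /util /dot /= subr0 big1 // => i _.
by rewrite tnth_nseq mulr0.
Qed.

Lemma dot_le_sum v q : nonneg_vec v -> (forall i, 0 <= tnth q i <= 1) ->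
  dot v q <= \sum_i tnth v i.
Proof.
move=> v0 q01; apply: ler_sum => i _.
by have /andP[_ q1] := q01 i; rewrite ler_piMr.
Qed.

(** The factor of [e] depends on [v] alone, so one representative per cell of a fine enough grid
    approximates every option of that cell. *)
Lemma util_diff_le v o o' (e : R) :
  (forall i, `|tnth o.1 i - tnth o'.1 i| <= e) -> `|o.2 - o'.2| <= e ->
  util v o - util v o' <= e * (\sum_i `|tnth v i| + 1).
Proof.
move=> qe pe; rewrite /util /dot.
have -> : forall a b x y : R, a - x - (b - y) = (a - b) - (x - y).
  by move=> *; ring.
rewrite -sumrB mulrDr mulr1 mulr_sumr lerD //; last first.
  by rewrite lerNl; move: pe; rewrite ler_norml => /andP[].
apply: ler_sum => i _; rewrite -mulrBr mulrC.
by apply: (le_trans (ler_norm _)); rewrite normrM ler_wpM2r.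
Qed.

(* One option of A is picked in each cell of each grid of mesh 1/(n+1); these
   countably many options are dense in A. *)
Lemma measurable_exists_util_gt (A : set (opt R k)) (a : R) :
  measurable [set v : vec R k | exists2 o, A o & a < util v o].
Proof.
pose idx := (nat * (k.-tuple int * int))%type.
pose cell (x : idx) : set (opt R k) := [set o |
  [/\ A o, [tuple Num.floor (x.1.+1%:R * tnth o.1 i) | i < k] = x.2.1
     & Num.floor (x.1.+1%:R * o.2) = x.2.2]].
(* The representative of a cell does not depend on [v], so each member of the union is measurable.
   Nonemptiness rules out the default [null_opt], which may lie outside [A]. *)
rewrite (_ : [set v | _] = \bigcup_(x in [set: idx])
    [set v | cell x !=set0 /\ a < util v (xget (null_opt R k) (cell x))]).
  apply: (@countable_bigcupT_measurable _ _ idx) => [|x].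
    exact: countableP.
  have [c0|c0] := pselect (cell x !=set0); last first.
    by rewrite (_ : [set v | _] = set0) //; apply/seteqP; split => v [].
  rewrite (_ : [set v | _] =
      [set: vec R k] `&`
      (fun v => util v (xget (null_opt R k) (cell x))) @^-1` `]a, +oo[).
    by apply: measurable_util => //; exact: measurable_itv.
  by apply/seteqP; split => v /=; rewrite in_itv/= andbT => -[].
have floor_close (m : nat) (x y : R) :
    Num.floor (m.+1%:R * x) = Num.floor (m.+1%:R * y) -> `|x - y| <= m.+1%:R^-1.
  move=> xy; have := floor_itv (m.+1%:R * x); have := floor_itv (m.+1%:R * y).
  rewrite xy => /andP[y1 y2] /andP[x1 x2].
  rewrite -(ler_pM2l (ltr0Sn R m)) mulfV ?pnatr_eq0 //.
  rewrite -[X in X * _ <= _](@ger0_norm R) ?ler0n // -normrM mulrBr.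
  move: x1 x2 y1 y2; rewrite intrD => x1 x2 y1 y2.
  by rewrite ler_norml; apply/andP; split; lra.
apply/seteqP; split => v /=; last first.
  move=> [x _ [c0 ua]]; have [Ax _ _] := xgetPex (null_opt R k) c0.
  by exists (xget (null_opt R k) (cell x)).
move=> [ o Ao ao].
have s0 : 0 < \sum_i `|tnth v i| + 1 by rewrite ltr_wpDl // sumr_ge0.
(* The mesh is chosen so that moving within a cell changes the utility by less than the gap
   [util v o - a]. *)
pose m := Num.truncn ((\sum_i `|tnth v i| + 1) / (util v o - a)).
have hm : m.+1%:R^-1 * (\sum_i `|tnth v i| + 1) < util v o - a.
  rewrite mulrC ltr_pdivrMr ?ltr0n // mulrC -ltr_pdivrMr ?subr_gt0 //.
  exact: truncnS_gt.
pose x : idx := (m, ([tuple Num.floor (m.+1%:R * tnth o.1 i) | i < k],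
                     Num.floor (m.+1%:R * o.2))).
have xo : cell x o by split.
exists x => //; split; first by exists o.
have [_ e1 e2] := xgetPex (null_opt R k) (ex_intro _ o xo : cell x !=set0).
set o' := xget _ _ in e1 e2 *.
have qe i : `|tnth o.1 i - tnth o'.1 i| <= m.+1%:R^-1.
  apply/floor_close/esym.
  by have := congr1 (fun t => tnth t i) e1; rewrite !tnth_mktuple.
have pe : `|o.2 - o'.2| <= m.+1%:R^-1 by exact/floor_close/esym.
by have := le_lt_trans (util_diff_le v qe pe) hm; rewrite ltrD2l ltrN2.
Qed.

End Utility.

(** * Compact sets of options, maximizers and measurable selections *)

Section Menu.
Variables (R : realType) (k : nat).
Implicit Types (v : vec R k) (o : opt R k) (A : set (opt R k)).

(* k.-tuple R carries no topology: compactness of a set of options is expressed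
   on its preimage in 'rV[R]_k * R. *)
Definition opt_of_row (x : 'rV[R]_k * R) : opt R k :=
  ([tuple x.1 0 i | i < k], x.2).

Definition row_of_opt o : 'rV[R]_k * R := (\row_i tnth o.1 i, o.2).

Lemma row_of_optK : cancel row_of_opt opt_of_row.
Proof.
by case=> q p; congr pair; apply: eq_from_tnth => i; rewrite tnth_mktuple mxE.
Qed.

Definition compact_opts A := compact (opt_of_row @^-1` A).

Lemma util_continuous v : continuous (fun x => util v (opt_of_row x)).
Proof.
rewrite (_ : (fun x => _) =
  fun x : 'rV[R]_k * R => \sum_i (tnth v i * x.1 0 i) - x.2); last first.
  apply/funext => x; rewrite /util /dot /=; congr (_ - _).
  by apply: eq_bigr => i _; rewrite tnth_mktuple.
move=> x; apply: cvgB; last exact: cvg_snd.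
apply: cvg_big => [|i _]; first exact: add_continuous.
apply: cvgM; first exact: cvg_cst.
apply: (@continuous_comp _ _ _ fst (fun y : 'rV[R]_k => y 0 i)).
  exact: cvg_fst.
exact: coord_continuous.
Qed.

Definition lexmax v A o := A o /\
  forall o', A o' -> util v o' <= util v o /\
    (util v o' = util v o -> o'.2 <= o.2).

(** The extreme value theorem is applied twice: to the utility on [A], then to the price on the
    compact set [B] of utility maximizers. *)
Lemma compact_lexmax v A : compact_opts A -> A !=set0 -> exists o, lexmax v A o.
Proof.
move=> cA [ o0 Ao0]; set A' := opt_of_row @^-1` A in cA.
have A'0 : A' !=set0 by exists (row_of_opt o0); rewrite /A' /= row_of_optK.
have [x /set_mem Ax xmax] := compact_EVT_max A'0 cA
  (continuous_subspaceT (@util_continuous v)).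
pose B := A' `&` [set y | util v (opt_of_row x) <= util v (opt_of_row y)].
have cB : compact B.
  apply: compact_closedI => //.
  apply: (@preimage_closed _ _ (fun y => util v (opt_of_row y))
    [set r | util v (opt_of_row x) <= r]).
    by move=> y _; exact: util_continuous.
  exact: closed_ge.
have B0 : B !=set0 by exists x; split => /=.
have cs : continuous (snd : 'rV[R]_k * R -> R) by move=> y; exact: cvg_snd.
have [y /set_mem[Ay xy] ymax] :=
  compact_EVT_max B0 cB (continuous_subspaceT cs).
exists (opt_of_row y); split => // o' Ao'.
have A'o' : A' (row_of_opt o') by rewrite /A' /= row_of_optK.
have o'x : util v o' <= util v (opt_of_row x).
  by have := xmax _ (mem_set A'o'); rewrite row_of_optK.
split; first exact: le_trans xy.
move=> o'y; have := ymax (row_of_opt o'); apply; apply/mem_set; split => //=.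
by rewrite row_of_optK o'y.
Qed.

Lemma compact_opts_set1 o : compact_opts [set o].
Proof.
rewrite /compact_opts (_ : _ @^-1` _ = [set row_of_opt o]).
  exact: compact_set1.
apply/seteqP; split => [[x p] /= <-|x /= ->]; last by rewrite row_of_optK.
by congr pair; apply/rowP => i; rewrite mxE tnth_mktuple.
Qed.

Lemma compact_opts0 : compact_opts set0.
Proof. by rewrite /compact_opts preimage_set0; exact: compact0. Qed.

Lemma compact_opts_ge A (t : R) :
  compact_opts A -> compact_opts (A `&` [set o | t <= o.2]).
Proof.
move=> cA; rewrite /compact_opts preimage_setI; apply: compact_closedI => //.
apply: (@preimage_closed _ _ (fun y : 'rV[R]_k * R => y.2) [set r | t <= r]).
  by move=> y _; exact: cvg_snd.
exact: closed_ge.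
Qed.

(** The union of the layers need not be compact; prices growing without bound along the layers make
    up for it. *)
Definition menu_layers (C : nat -> set (opt R k)) : Prop :=
  [/\ forall n, compact_opts (C n),
      forall n o, C n o -> forall i, 0 <= tnth o.1 i <= 1
    & forall B : R, exists N, forall n, (N <= n)%N ->
        forall o, C n o -> B < o.2].

(** An allocation is worth at most the sum of the values, so late layers are too expensive to
    compete with a given option [o0]. The finitely many remaining layers have a compact union
    [K N]. *)
Lemma menu_lexmax (C : nat -> set (opt R k)) v :
  menu_layers C -> nonneg_vec v -> \bigcup_n C n !=set0 ->
  exists o, lexmax v (\bigcup_n C n) o.
Proof.
move=> [cC C01 Cinf] v0 [ o0 [n0 _ Co0]].
have [N hN] := Cinf (\sum_i tnth v i - util v o0).
have utilN n o : (N <= n)%N -> C n o -> util v o < util v o0.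
  move=> Nn Co; have := hN n Nn o Co; have := dot_le_sum v0 (C01 n o Co).
  by rewrite [util v o]/util; lra.
pose K m := [set o | exists2 n, (n < m)%N & C n o].
have cK m : compact_opts (K m).
  elim: m => [|m IH].
    rewrite (_ : K 0 = set0); first exact: compact_opts0.
    by apply/seteqP; split => // o [].
  rewrite (_ : K m.+1 = K m `|` C m).
    by rewrite /compact_opts preimage_setU; apply: compactU; last exact: cC.
  apply/seteqP; split => [ o [n]|o [[n nm Cn]|Co]].
  - rewrite ltnS leq_eqVlt => /orP[/eqP ->|nm] Co; first by right.
    by left; exists n.
  - by exists n => //; exact: ltnW.
  - by exists m.
have KN n o : C n o -> util v o0 <= util v o -> K N o.
  move=> Co o0o; exists n => //; rewrite ltnNge; apply/negP => Nn.
  by have := utilN n o Nn Co; rewrite ltNge o0o.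
have Ko0 : K N o0 by exact: KN Co0 _.
have [ o [[n nN Co] omax]] := compact_lexmax v (cK N) (ex_intro _ o0 Ko0).
have o0o : util v o0 <= util v o by have [] := omax _ Ko0.
exists o; split; first by exists n.
move=> o' [n' _ Co']; have [ o0o'|o'o0] := leP (util v o0) (util v o').
  exact: omax (KN _ _ Co' o0o').
have o'o := lt_le_trans o'o0 o0o.
by split; [exact: ltW|move=> e; move: o'o; rewrite e ltxx].
Qed.

Lemma menu_layers_ge (C : nat -> set (opt R k)) (t : R) :
  menu_layers C -> menu_layers (fun n => C n `&` [set o | t <= o.2]).
Proof.
move=> [cC C01 Cinf]; split.
- by move=> n; exact: compact_opts_ge.
- by move=> n o [/C01].
- by move=> B; have [N hN] := Cinf B; exists N => n Nn o [/(hN n Nn)].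
Qed.

(* Breaking ties in favour of the highest price makes the price measurable: it
   is below t exactly when some rational separates the best utility in the menu
   from the best utility among options of price at least t. *)
Lemma menu_selection (C : nat -> set (opt R k)) :
  menu_layers C -> \bigcup_n C n !=set0 ->
  exists sel : vec R k -> opt R k,
    [/\ forall v, nonneg_vec v -> lexmax v (\bigcup_n C n) (sel v),
        forall v, ~ nonneg_vec v -> sel v = null_opt R k
      & measurable_fun [set: vec R k] (fun v => (sel v).2)].
Proof.
move=> hC C0; set M := \bigcup_n C n.
pose sel v := if `[< nonneg_vec v >] then xget (null_opt R k) (lexmax v M)
              else null_opt R k.
have selP v : nonneg_vec v -> lexmax v M (sel v).
  move=> v0; rewrite /sel asboolT //.
  exact: (xgetPex (null_opt R k) (menu_lexmax hC v0 C0)).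
have selN v : ~ nonneg_vec v -> sel v = null_opt R k.
  by move=> v0; rewrite /sel asboolF.
exists sel; split => // mT.
apply: (measurability _ (RGenInftyO.measurableE R)) => //.
move=> /= _ [_ [t ->] <-]; rewrite setTI.
pose above (A : set (opt R k)) (a : rat) :=
  [set v : vec R k | exists2 o, A o & ratr a < util v o].
(* Off the nonnegative orthant the price is 0, which is below [t] exactly when [0 < t]. *)
rewrite (_ : _ @^-1` _ =
  ([set v | nonneg_vec v] `&`
    \bigcup_(a in [set: rat])
      (above M a `\` above (M `&` [set o | t <= o.2]) a))
  `|` (~` [set v | nonneg_vec v] `&` [set v | (0 : R) < t])).
  have mN := @measurable_nonneg_vec R k.
  apply: measurableU; apply: measurableI => //.
  - apply: bigcupT_measurable_rat => a; apply: measurableD;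
      exact: measurable_exists_util_gt.
  - exact: measurableC.
  - case: (ltP 0 t) => t0.
      by rewrite (_ : [set v | _] = setT) //; apply/seteqP; split.
    by rewrite (_ : [set v | _] = set0) //; apply/seteqP; split.
apply/seteqP; split => v /=; rewrite in_itv /=.
  move=> pt; have [v0|v0] := pselect (nonneg_vec v); last first.
    by right; split => //; move: pt; rewrite selN.
  left; split => //; have [Ms smax] := selP v v0.
  suff [a [a1 a2]] : exists a : rat, ratr a < util v (sel v) /\
      forall o, M o -> t <= o.2 -> util v o <= ratr a.
    exists a => //; split; first by exists (sel v).
    by move=> [ o [Mo to]]; rewrite ltNge a2.
  have [Mt|Mt] := pselect (M `&` [set o | t <= o.2] !=set0); last first.
    have /rat_in_itvoo[a] : util v (sel v) - 1 < util v (sel v) by lra.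
    rewrite in_itv /= => /andP[_ a1]; exists a; split => // o Mo to.
    by exfalso; apply: Mt; exists o.
  rewrite setI_bigcupl in Mt.
  have [ o1 [ o1M o1max]] := menu_lexmax (menu_layers_ge t hC) v0 Mt.
  rewrite -setI_bigcupl in o1M o1max; have {o1M} [ o1M to1] := o1M.
  have [le1 eq1] := smax o1 o1M.
  (* A tie would give [sel v] a price at least that of [o1], hence at least [t]. *)
  have /rat_in_itvoo[a] : util v o1 < util v (sel v).
    rewrite lt_neqAle le1 andbT; apply/eqP => /eq1 e.
    by move: pt; rewrite ltNge (le_trans _ e).
  rewrite in_itv /= => /andP[a1 a2]; exists a; split => // o Mo to.
  by apply: (le_trans _ (ltW a1)); have [] := o1max o (conj Mo to).
case=> [[v0 [a _ [[ o' Mo' ao'] nab]]]|[v0 t0]]; last by rewrite selN.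
rewrite ltNge; apply/negP => ts; apply: nab; have [Ms smax] := selP v v0.
by exists (sel v) => //; apply: (lt_le_trans ao'); have [] := smax _ Mo'.
Qed.

End Menu.

(** * The truncated and enlarged menu of one parity *)

Section ParityMenu.
Variables (R : realType) (k : nat) (c : R) (sel : vec R k -> opt R k).
Implicit Types (v w : vec R k) (o : opt R k) (t : nat -> R) (b : bool).

(* Indices are shifted by one: layer n.+1 is bin n, layer 0 the null option. *)
Definition parity_layer b t (m : nat) : set (opt R k) :=
  if m is n.+1 then
    [set o | [/\ odd n = b, forall i, 0 <= tnth o.1 i <= 1,
                 c * 2 ^+ n <= o.2 <= t n
               & forall v, nonneg_vec v -> util v o <= util v (sel v)]]
  else [set null_opt R k].

(** A nonempty bin layer is a closed box cut by closed half-spaces, one per buyer; the truncation at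
    [t n] is what closes the price interval. *)
Lemma compact_parity_layer b t m : compact_opts (parity_layer b t m).
Proof.
case: m => [|n]; first exact: compact_opts_set1.
have [nb|nb] := eqVneq (odd n) b; last first.
  rewrite (_ : parity_layer b t n.+1 = set0); first exact: compact_opts0.
  by apply/seteqP; split => // o [/eqP]; rewrite (negbTE nb).
pose box := [set x : 'rV[R]_k | forall i, `[(0 : R), 1]%classic (x ord0 i)] `*`
  `[c * 2 ^+ n, t n]%classic.
pose below := \bigcap_(v in [set v | nonneg_vec v])
  [set x : 'rV[R]_k * R | util v (opt_of_row x) <= util v (sel v)].
rewrite /compact_opts (_ : _ @^-1` _ = box `&` below).
  have cbox : compact box.
    apply: compact_setX; last exact: segment_compact.
    by apply: (@rV_compact R k (fun=> `[(0 : R), 1]%classic)) => i;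
      exact: segment_compact.
  apply: compact_closedI => //.
  apply: closed_bigI => v _.
  apply: (@preimage_closed _ _ (fun y => util v (opt_of_row y))
    [set r | r <= util v (sel v)]).
    by move=> y _; exact: util_continuous.
  exact: closed_le.
apply/seteqP; split => [x /= [_ q01 p1 hv]|x /= [[q01 p1] hv]].
  split; last by move=> v; exact: hv.
  split=> [i|] /=; rewrite in_itv //=.
  by have := q01 i; rewrite tnth_mktuple.
split => // i; have := q01 i.
by rewrite tnth_mktuple /= in_itv.
Qed.

Lemma parity_layers_menu b t : 0 < c -> menu_layers (parity_layer b t).
Proof.
move=> c0; split.
- exact: compact_parity_layer.
- move=> [|n] o /=; last by case.
  by move=> -> i; rewrite tnth_nseq lexx ler01.
(* One successor passes [B / c], the other accounts for the index shift; then [n <= 2 ^ n]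
   concludes. *)
- move=> B; exists (Num.truncn (B / c)).+2 => -[//|n].
  rewrite ltnS => Nn o /= [_ _ /andP[p1 _] _]; apply: (lt_le_trans _ p1).
  rewrite mulrC -ltr_pdivrMr // (lt_le_trans (truncnS_gt _)) // -natrX ler_nat.
  exact: leq_trans Nn (ltnW (ltn_expl n (ltnSn 1))).
Qed.

Variable M : set (opt R k).
Hypotheses (hM : mechanism M) (hMc : expensive c M) (hsel : selection M sel).

Lemma util_sel_ge0 v : nonneg_vec v -> 0 <= util v (sel v).
Proof.
by move=> v0; have [_ /(_ _ hM.1)] := hsel v0; rewrite util_null.
Qed.

Lemma sel_price v : nonneg_vec v -> (sel v).2 = 0 \/ c <= (sel v).2.
Proof.
move=> v0; have [Ms _] := hsel v0.
by have [->|/(hMc Ms)] := pselect (sel v = null_opt R k); [left|right].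
Qed.

Definition scaled_opt (s : R) o : opt R k :=
  ([tuple s * tnth o.1 i | i < k], s * o.2).

Lemma util_scaled_opt v (s : R) o : util v (scaled_opt s o) = s * util v o.
Proof.
rewrite /util /dot /= mulrBr mulr_sumr; congr (_ - _).
by apply: eq_bigr => i _; rewrite tnth_mktuple mulrCA.
Qed.

(** Nothing in the new menu beats [sel v]. If [sel v] is itself in the menu it is therefore a
    maximizer, and breaking ties towards high prices can only raise the payment. *)
Lemma parity_mechanism b t : 0 < c -> (forall n, t n < c * 2 ^+ n.+1) ->
  exists (M' : set (opt R k)) (sel' : vec R k -> opt R k),
  [/\ mechanism M' /\ expensive c M',
      forall o, M' o -> o <> null_opt R k ->
        exists n, odd n = b /\ c * 2 ^+ n <= o.2 < c * 2 ^+ n.+1,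
      selection M' sel' /\ measurable_fun [set: vec R k] (fun v => (sel' v).2),
      forall v, 0 <= (sel' v).2 &
      (forall v n, nonneg_vec v -> odd n = b ->
        c * 2 ^+ n <= (sel v).2 <= t n ->
        (sel v).2 <= (sel' v).2) /\
      (forall v, b = false -> c <= t 0 -> nonneg_vec v -> c <= (sel v).2 ->
        c <= (sel' v).2)].
Proof.
move=> c0 ht; have hC := parity_layers_menu b t c0.
pose M' := \bigcup_n parity_layer b t n.
have M'null : M' (null_opt R k) by exists 0%N.
have M'01 o : M' o -> forall i, 0 <= tnth o.1 i <= 1.
  by move=> [n _ Cn]; case: hC => _ /(_ n o Cn).
have M'p o : M' o -> o <> null_opt R k ->
    exists n, odd n = b /\ c * 2 ^+ n <= o.2 < c * 2 ^+ n.+1.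
  move=> [[|n] _ //= [nb _ /andP[p1 p2] _]] _; exists n; split => //.
  by rewrite p1 (le_lt_trans p2).
have M'c : expensive c M'.
  move=> o Mo /(M'p o Mo)[n [_ /andP[p1 _]]]; apply: le_trans p1.
  by rewrite ler_peMr ?(ltW c0) // exprn_ege1 // ler1n.
have M'u v o : nonneg_vec v -> M' o -> util v o <= util v (sel v).
  move=> v0 [[|n] _ /= Co]; last by case: Co => _ _ _; exact.
  by rewrite Co util_null util_sel_ge0.
have [sel' [lex' null' meas']] := menu_selection hC (ex_intro _ _ M'null).
rewrite -/M' in lex'.
exists M', sel'; split => //.
- by split => //; move=> v v0; have [? h] := lex' v v0; split => // o /h[].
- move=> v; have [v0|v0] := pselect (nonneg_vec v); last by rewrite null'.
  have [Ms _] := lex' v v0.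
  have [->//|/(M'c _ Ms)] := pselect (sel' v = null_opt R k).
  exact/le_trans/ltW.
split.
  move=> v n v0 nb p12; have [Ms' h] := lex' v v0.
  have [Ms smax] := hsel v0.
  have M's : M' (sel v).
    exists n.+1 => //=; split => //; first exact: hM.2.
    by move=> w w0; have [_] := hsel w0; exact.
  have [le1] := h _ M's; apply; apply/eqP; rewrite eq_le le1.
  exact: M'u.
move=> v b0 ct v0 cp; have [Ms' h] := lex' v v0; have [Ms smax] := hsel v0.
have p0 : 0 < (sel v).2 by exact: lt_le_trans cp.
pose s := c / (sel v).2; pose o' := scaled_opt s (sel v).
have s0 : 0 < s by rewrite divr_gt0.
have s1 : s <= 1 by rewrite ler_pdivrMr // mul1r.
have o'2 : o'.2 = c by rewrite /= /s divfK // gt_eqF.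
(* Layer 1 is bin 0. For a buyer [w], scaling by [s <= 1] gives at most [s * util w (sel w)], which
   is at most [util w (sel w)] because the latter is nonnegative. *)
have M'o' : M' o'.
  exists 1%N => //; split; first by rewrite b0.
  - move=> i; have /andP[q0 q1] := hM.2 _ Ms i.
    by rewrite tnth_mktuple mulr_ge0 ?(ltW s0) //= mulr_ile1 // ltW.
  - by rewrite o'2 expr0 mulr1 lexx ct.
  - move=> w w0; rewrite util_scaled_opt.
    have uw := util_sel_ge0 w0; have [_ /(_ _ Ms) u1] := hsel w0.
    apply: (le_trans (y := s * util w (sel w))); first by rewrite ler_pM2l.
    by rewrite ler_piMl.
(* If the null option were selected, [o'] would tie with it at utility 0, and the tie-breaking rule
   gives the bound. *)
have [e|/(M'c _ Ms')//] := pselect (sel' v = null_opt R k).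
have [le1 eq1] := h _ M'o'; rewrite e util_null in le1 eq1.
rewrite e -o'2; apply: eq1; apply/eqP; rewrite eq_le le1 util_scaled_opt.
by rewrite mulr_ge0 ?(ltW s0) ?util_sel_ge0.
Qed.

End ParityMenu.

(** * Dyadic bins and the loss near their tops *)

Lemma dyadic_bin (R : realType) (c x : R) : 0 < c -> c <= x ->
  exists n, c * 2 ^+ n <= x < c * 2 ^+ n.+1.
Proof.
move=> c0 cx.
have ex : exists n, x < c * 2 ^+ n.+1.
  exists (Num.truncn (x / c)); rewrite mulrC -ltr_pdivrMr //.
  rewrite (lt_le_trans (truncnS_gt _)) // -natrX ler_nat.
  exact: ltnW (ltn_expl _ (ltnSn 1)).
have [[|n] xn minn] := ex_minnP ex.
  by exists 0%N; rewrite expr0 mulr1 cx.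
exists n.+1; rewrite xn andbT leNgt; apply/negP => /minn.
by rewrite ltnn.
Qed.

Section NearTop.
Context (d : measure_display) (T : measurableType d) (R : realType).
Variables (D : probability T R) (f : T -> R).
Hypothesis mf : measurable_fun [set: T] f.

(** The points [t m] increase from [a] towards [b], so the preimages of []t m, b[] decrease to the
    empty set and continuity from above applies. *)
Lemma probability_near_below (a b e : R) : a < b -> 0 < e ->
  exists t, a <= t < b /\ (D (f @^-1` `]t, b[) <= e%:E)%E.
Proof.
move=> ab e0; pose t (m : nat) := b - (b - a) / m.+1%:R.
have tab m : a <= t m < b.
  have h : 0 < (b - a) / m.+1%:R by rewrite divr_gt0 ?subr_gt0 ?ltr0n.
  have h' : (b - a) / m.+1%:R <= b - a.
    by rewrite ler_pdivrMr ?ltr0n // ler_peMr ?subr_ge0 ?(ltW ab) // ler1n.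
  by move: h h'; rewrite /t; move: (_ / _) => z h h'; apply/andP; split; lra.
pose F m := f @^-1` `]t m, b[.
have mF m : measurable (F m).
  by rewrite -[F m]setTI; apply: mf => //; exact: measurable_itv.
have F0 : \bigcap_m F m = set0.
  apply/seteqP; split => // x Fx.
  have xb : f x < b by have := Fx 0%N I; rewrite /F /= in_itv /= => /andP[].
  have := Fx (Num.truncn ((b - a) / (b - f x))) I.
  rewrite /F /= in_itv /= => /andP[+ _]; rewrite /t.
  set m := Num.truncn _.
  have : (b - a) / m.+1%:R < b - f x.
    rewrite ltr_pdivrMr ?ltr0n // mulrC -ltr_pdivrMr ?subr_gt0 //.
    exact: truncnS_gt.
  by move: (_ / _) => z; lra.
have Fcvg : (D \o F) m @[m --> \oo] --> D (\bigcap_m F m).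
  apply: nonincreasing_cvg_mu => //.
  - by rewrite (le_lt_trans (probability_le1 _ _)) ?ltry.
  - by rewrite F0.
  - move=> m n mn; apply/subsetPset => x; rewrite /F /= !in_itv /=.
    move=> /andP[h ->]; rewrite andbT; apply: le_lt_trans h.
    rewrite /t lerD2l lerN2 ler_wpM2l ?subr_ge0 ?(ltW ab) //.
    by rewrite lef_pV2 ?posrE ?ltr0n // ler_nat.
rewrite F0 measure0 in Fcvg.
have : \forall m \near \oo, (D (F m) < e%:E)%E.
  apply: (Fcvg [set y | (y < e%:E)%E]); apply: open_nbhs_nbhs; split.
    exact: open_ereal_lt_ereal.
  by rewrite /= lte_fin.
by move=> [m _ /(_ m (leqnn m)) /ltW hm]; exists (t m).
Qed.

(** The strip cut off bin [n] gets probability at most [e / 2 ^ n.+1 / b n]. Its indicator weighted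
    by the bin top [b n] dominates the prices there and has integral at most [e / 2 ^ n.+1]; [l] is
    the sum over all bins. *)
Lemma near_top_loss (c e : R) : 0 < c -> 0 < e ->
  exists (t : nat -> R) (l : T -> \bar R),
  [/\ forall n, c * 2 ^+ n <= t n < c * 2 ^+ n.+1,
      measurable_fun [set: T] l,
      forall x, (0 <= l x)%E,
      (\int[D]_x l x <= e%:E)%E
    & forall x n, t n < f x < c * 2 ^+ n.+1 -> ((f x)%:E <= l x)%E].
Proof.
move=> c0 e0; pose b (n : nat) : R := c * 2 ^+ n.+1.
have b0 n : 0 < b n by rewrite mulr_gt0 ?exprn_gt0.
have /choice[t ht] : forall n, exists t : R, c * 2 ^+ n <= t < b n /\
    (D (f @^-1` `]t, b n[) <= (e / (2 ^ n.+1)%:R / b n)%:E)%E.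
  move=> n; apply: probability_near_below.
    by rewrite /b exprS ltr_pM2l // ltr_pMl ?exprn_gt0 // ltr1n.
  by rewrite !divr_gt0 // ltr0n expn_gt0.
pose S n := f @^-1` `]t n, b n[.
have mS n : measurable (S n).
  by rewrite -[S n]setTI; apply: mf => //; exact: measurable_itv.
pose g n x := (b n * \1_(S n) x)%:E.
have g0 n x : (0 <= g n x)%E.
  by rewrite lee_fin mulr_ge0 // (ltW (b0 n)).
have mg n : measurable_fun [set: T] (g n).
  by apply/measurable_EFinP; exact: measurable_funM.
exists t, (fun x => \sum_(n <oo) g n x)%E; split.
- by move=> n; have [] := ht n.
- by apply: ge0_emeasurable_sum => // n x _ _.
- by move=> x; apply: nneseries_ge0.
- rewrite integral_nneseries //.
  apply: (le_trans _ (epsilon_trick0 xpredT (ltW e0))).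
  apply: lee_nneseries => n _; first by move=> _; exact: integral_ge0.
  rewrite /g; under eq_integral do rewrite EFinM.
  rewrite ge0_integralZl //; last 2 first.
  + by apply/measurable_EFinP; exact: measurable_indic.
  + by rewrite lee_fin (ltW (b0 n)).
  rewrite integral_indic // setIT.
  have [_ hn] := ht n; apply: (le_trans (lee_wpmul2l _ hn)).
    by rewrite lee_fin (ltW (b0 n)).
  by rewrite -EFinM lee_fin mulrC divfK // gt_eqF.
- move=> x n /andP[x1 x2].
  apply: (le_trans _ (nneseries_lim_ge n.+1 _)) => //.
  rewrite big_nat_recr //= -[leLHS]add0e.
  apply: leeD; first exact: sume_ge0.
  have Sx : S n x by rewrite /S /= in_itv /= x1.
  by rewrite lee_fin indicE mem_set // mulr1 ltW.
Qed.

End NearTop.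

(** * Comparison of the revenues of the two menus with that of M *)

Section Revenue.
Variables (R : realType) (k : nat) (c : R) (D : probability (vec R k) R).
Variables (M : set (opt R k)) (sel : vec R k -> opt R k).
Hypotheses (c0 : 0 < c) (hD : D [set v | nonneg_vec v] = 1%E).
Hypotheses (hM : mechanism M) (hMc : expensive c M) (hsel : selection M sel).
Hypothesis hselm : measurable_fun [set: vec R k] (fun v => (sel v).2).

Definition parity_mech (b : bool) (M' : set (opt R k))
    (sel' : vec R k -> opt R k) : Prop :=
  [/\ mechanism M', expensive c M',
      if b then oddly_priced c M' else evenly_priced c M',
      selection M' sel'
    & measurable_fun [set: vec R k] (fun v => (sel' v).2)].

Definition odd_buyers : set (vec R k) := [set v | nonneg_vec v] `&`
  \bigcup_(n in [set n | odd n])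
    (fun v => (sel v).2) @^-1` `[c * 2 ^+ n, c * 2 ^+ n.+1[.

Lemma measurable_odd_buyers : measurable odd_buyers.
Proof.
apply: measurableI; first exact: measurable_nonneg_vec.
apply: bigcup_measurable => n _; rewrite -[X in measurable X]setTI.
by apply: hselm => //; exact: measurable_itv.
Qed.

(** Outside the nonnegative orthant [sel] is arbitrary and its price may be negative. The indicator
    makes the integrand nonnegative everywhere and changes it only on a null set. *)
Definition sel_price_nonneg (v : vec R k) : R :=
  (sel v).2 * \1_[set v | nonneg_vec v] v.

Lemma measurable_sel_price_nonneg :
  measurable_fun [set: vec R k] (fun v => (sel_price_nonneg v)%:E).
Proof.
have mN := @measurable_nonneg_vec R k.
by apply/measurable_EFinP; exact: measurable_funM.
Qed.

Lemma sel_price_nonnegE v : nonneg_vec v -> sel_price_nonneg v = (sel v).2.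
Proof. by move=> v0; rewrite /sel_price_nonneg indicE mem_set // mulr1. Qed.

Lemma sel_price_nonneg0 v : ~ nonneg_vec v -> sel_price_nonneg v = 0.
Proof. by move=> v0; rewrite /sel_price_nonneg indicE memNset // mulr0. Qed.

Lemma sel_price_nonneg_ge0 v : 0 <= sel_price_nonneg v.
Proof.
have [v0|v0] := pselect (nonneg_vec v); last by rewrite sel_price_nonneg0.
rewrite sel_price_nonnegE //.
by have [->//|] := sel_price hMc hsel v0; exact/le_trans/ltW.
Qed.

Lemma Rev_sel_price_nonneg :
  Rev D sel = (\int[D]_v (sel_price_nonneg v)%:E)%E.
Proof.
apply: ae_eq_integral => //; first exact/measurable_EFinP.
  exact: measurable_sel_price_nonneg.
exists (~` [set v | nonneg_vec v]); split.
- exact: measurableC (@measurable_nonneg_vec R k).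
- have := probability_setC D (@measurable_nonneg_vec R k).
  by rewrite hD subee.
- move=> v /= h v0; apply: h => _.
  by rewrite sel_price_nonnegE.
Qed.

Lemma parity_revenues (e : R) : 0 < e ->
  exists M0 sel0 M1 sel1, [/\ parity_mech false M0 sel0,
    parity_mech true M1 sel1,
    (Rev D sel + c%:E * D odd_buyers <= Rev D sel0 + Rev D sel1 + e%:E)%E,
    D odd_buyers = 0%E -> (Rev D sel <= Rev D sel0 + e%:E)%E
    & (0 <= Rev D sel0)%E].
Proof.
move=> e0; have [t [l [ht ml l0 le lP]]] := near_top_loss D hselm c0 e0.
have ht' n : t n < c * 2 ^+ n.+1 by have /andP[] := ht n.
have [M0 [s0 [[hM0 hMc0] par0 [hs0 ms0] pos0 [keep0 low0]]]] :=
  parity_mechanism hM hsel false c0 ht'.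
have [M1 [s1 [[hM1 hMc1] par1 [hs1 ms1] pos1 [keep1 _]]]] :=
  parity_mechanism hM hsel true c0 ht'.
have mO := measurable_odd_buyers.
pose p0 v := (s0 v).2%:E; pose p1 v := (s1 v).2%:E.
pose p v := (sel_price_nonneg v)%:E.
have mp0 : measurable_fun [set: vec R k] p0 by exact/measurable_EFinP.
have mp1 : measurable_fun [set: vec R k] p1 by exact/measurable_EFinP.
have mp : measurable_fun [set: vec R k] p by exact: measurable_sel_price_nonneg.
have p0_ge0 v : (0 <= p0 v)%E by rewrite lee_fin.
have p1_ge0 v : (0 <= p1 v)%E by rewrite lee_fin.
have p_ge0 v : (0 <= p v)%E by rewrite lee_fin sel_price_nonneg_ge0.
have ct0 : c <= t 0 by have /andP[] := ht 0%N; rewrite expr0 mulr1.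
pose I v := (c * \1_odd_buyers v)%:E.
have I0 v : (0 <= I v)%E by rewrite lee_fin mulr_ge0 // ltW.
have mI : measurable_fun [set: vec R k] I.
  by apply/measurable_EFinP; apply: measurable_funM.
have intI : (\int[D]_v I v = c%:E * D odd_buyers)%E.
  rewrite /I; under eq_integral do rewrite EFinM.
  rewrite ge0_integralZl //; last 2 first.
  - by apply/measurable_EFinP; exact: measurable_indic.
  - by rewrite lee_fin ltW.
  by rewrite integral_indic // setIT.
have notO v : ~ odd_buyers v -> I v = 0%E.
  by move=> nO; rewrite /I indicE memNset // mulr0.
have I_le v : (I v <= c%:E)%E.
  by rewrite lee_fin indicE; case: (_ \in _); rewrite ?mulr1 // mulr0 ltW.
(* For a buyer in a cut-off strip [l] covers [p]; otherwise the menu of the matching parity does. If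
   the buyer is odd, [p0] covers the bonus [I], being at least [c]. *)
have pointwise v : (p v + I v <= p0 v + p1 v + l v)%E /\
    (~ odd_buyers v -> (p v <= p0 v + l v)%E).
  have zero : p v = 0%E -> ~ odd_buyers v ->
      (p v + I v <= p0 v + p1 v + l v)%E /\
      (~ odd_buyers v -> (p v <= p0 v + l v)%E).
    by move=> pv nO; rewrite pv notO // add0e; split => [|_]; rewrite !adde_ge0.
  have [v0|v0] := pselect (nonneg_vec v); last first.
    by apply: zero; [rewrite /p sel_price_nonneg0|case].
  have pv : p v = (sel v).2%:E by rewrite /p sel_price_nonnegE.
  have [z|cp] := sel_price hMc hsel v0.
    apply: zero; first by rewrite pv z.
    move=> [_ [n _]] /=; rewrite z in_itv /= => /andP[+ _].
    by rewrite leNgt mulr_gt0 // exprn_gt0.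
  have [n /andP[n1 n2]] := dyadic_bin c0 cp.
  have c_p0 : (c%:E <= p0 v)%E by rewrite lee_fin low0.
  have [tn|tn] := ltP (t n) (sel v).2.
    have pl : (p v <= l v)%E by rewrite pv; apply: (lP v n); rewrite tn.
    split=> [|_]; last by rewrite -[leLHS]add0e leeD.
    rewrite addeC leeD // -[leLHS]adde0 leeD //.
    exact: le_trans (I_le v) c_p0.
  case nodd : (odd n).
    have Ov : odd_buyers v.
      by split => //; exists n => //=; rewrite in_itv /= n1.
    split=> [|//]; rewrite -[leLHS]adde0 leeD // addeC leeD //.
      exact: le_trans (I_le v) c_p0.
    by rewrite pv lee_fin (keep1 v n) // n1.
  have nOv : ~ odd_buyers v.
    move=> [_ [m mo]] /=; rewrite in_itv /= => /andP[m1 m2].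
    suff mn : m = n by rewrite -mn mo in nodd.
    have lt2 (i j : nat) : c * 2 ^+ i < c * 2 ^+ j.+1 -> (i <= j)%N.
      by rewrite ltr_pM2l // ltr_eXn2l ?ltr1n.
    apply/eqP; rewrite eqn_leq.
    by rewrite (lt2 m n (le_lt_trans m1 n2)) (lt2 n m (le_lt_trans n1 m2)).
  have pp0 : (p v <= p0 v)%E by rewrite pv lee_fin (keep0 v n) // n1.
  rewrite notO // adde0; split=> [|_].
    by rewrite -[leLHS]adde0 leeD // -[leLHS]adde0 leeD.
  by rewrite -[leLHS]adde0 leeD.
have RevE : Rev D sel = (\int[D]_v p v)%E by exact: Rev_sel_price_nonneg.
exists M0, s0, M1, s1; split.
- split => // o Mo /(par0 o Mo)[n [no np]]; exists n%:Z; split => /=.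
    by rewrite no.
  by rewrite -PoszD addn1.
- split => // o Mo /(par1 o Mo)[n [no np]]; exists n%:Z; split => //=.
  by rewrite -PoszD addn1.
- rewrite RevE -intI -ge0_integralD //.
  apply: (@le_trans _ _ (\int[D]_v (p0 v + p1 v + l v))%E).
    apply: ge0_le_integral => //.
    + by move=> v _; exact: adde_ge0.
    + exact: emeasurable_funD.
    + by apply: emeasurable_funD => //; exact: emeasurable_funD.
    + by move=> v _; have [] := pointwise v.
  rewrite ge0_integralD //; last 2 first.
  + by move=> v _; exact: adde_ge0.
  + exact: emeasurable_funD.
  by rewrite ge0_integralD // leeD2l.
- move=> O0; rewrite RevE.
  apply: (@le_trans _ _ (\int[D]_v (p0 v + l v))%E).
    (* The pointwise bound can fail only on [odd_buyers], a null set in this case. *)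
    apply: ae_ge0_le_integral => //.
    + by move=> v _; exact: adde_ge0.
    + exact: emeasurable_funD.
    exists odd_buyers; split => // v /= h; apply: contrapT => nO; apply: h => _.
    by have [_] := pointwise v; exact.
  by rewrite ge0_integralD // leeD2l.
- by apply: integral_ge0 => v _; exact: p0_ge0.
Qed.

End Revenue.

(** * Choice of the loss and of the better menu *)

Unset Implicit Arguments.
Set Strict Implicit.

Theorem claim4p4 (R : realType) (k : nat) (c : R) (hc : 0 < c)
  (D : probability (vec R k) R)
  (hD : D [set v | nonneg_vec v] = 1%E)
  (M : set (opt R k)) (sel : vec R k -> opt R k)
  (hM : mechanism M) (hMc : expensive c M) (hsel : selection M sel)
  (hselm : measurable_fun [set: vec R k] (fun v => (sel v).2)) :
  exists (M' : set (opt R k)) (sel' : vec R k -> opt R k),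
    mechanism M' /\ expensive c M' /\
    (oddly_priced c M' \/ evenly_priced c M') /\
    selection M' sel' /\
    measurable_fun [set: vec R k] (fun v => (sel' v).2) /\
    ((2^-1)%:E * Rev D sel <= Rev D sel')%E.
Proof.
suff [b [M' [sel' [[? ? hpar ? ?] ?]]]] : exists b M' sel',
    parity_mech c b M' sel' /\ ((2^-1)%:E * Rev D sel <= Rev D sel')%E.
  exists M', sel'; do 2 split => //; split => //.
  by case: b hpar; [left|right].
have revenues := parity_revenues hc hD hM hMc hsel hselm.
have A0 : (0 <= Rev D sel)%E.
  rewrite (Rev_sel_price_nonneg hD hselm); apply: integral_ge0 => v _.
  by rewrite lee_fin (sel_price_nonneg_ge0 hc hMc hsel).
have mO := measurable_odd_buyers c hselm.
have finO : D (odd_buyers c sel) \is a fin_num by exact: fin_num_measure.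
have [ O0|On0] := eqVneq (D (odd_buyers c sel)) 0%E.
  case: (Rev D sel) A0 revenues => [a| |] //= A0 revenues.
  - have [a0|a0] := ltP 0 a.
      (* Without odd buyers the even menu may lose half of the revenue [a]. *)
      have [|M0 [s0 [_ [_ [h0 _ _ /(_ O0) h _]]]]] := revenues (2^-1 * a).
        by rewrite mulr_gt0.
      exists false, M0, s0; split => //.
      rewrite -(leeD2rE (x := (2^-1 * a)%:E)) // (le_trans _ h) //.
      by rewrite -EFinM -EFinD lee_fin; lra.
    have [|M0 [s0 [_ [_ [h0 _ _ _ h]]]]] := revenues 1; first exact: ltr01.
    exists false, M0, s0; split => //; apply: le_trans h.
    by rewrite -EFinM lee_fin; move: a0; lra.
  (* Here [Rev D sel] is infinite, and a finite loss leaves the even revenue infinite. *)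
  - have [|M0 [s0 [_ [_ [h0 _ _ /(_ O0) h _]]]]] := revenues 1.
      exact: ltr01.
    exists false, M0, s0; split => //; apply: (le_trans (leey _)).
    by move: h; case: (Rev D s0).
(* The loss is set equal to the bonus from the odd buyers. The two cancel, so the revenues add up to
   at least [Rev D sel] and the larger one is at least half of it. *)
pose e := fine (c%:E * D (odd_buyers c sel)).
have eE : (c%:E * D (odd_buyers c sel))%E = e%:E.
  by rewrite fineK // fin_numM.
have e0 : 0 < e.
  by rewrite -lte_fin -eE mule_gt0 ?lte_fin // lt0e On0 measure_ge0.
have [M0 [s0 [M1 [s1 [h0 h1 h _ _]]]]] := revenues e e0.
rewrite eE leeD2rE // in h.
have [h01|h01] := leP (Rev D s0) (Rev D s1).
  exists true, M1, s1; split => //.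
  have : (Rev D sel <= Rev D s1 + Rev D s1)%E by rewrite (le_trans h) // leeD2r.
  by rewrite -mule2n -mule_natl -lee_pdivrMl.
exists false, M0, s0; split => //.
rewrite lee_pdivrMl // mule_natl mule2n (le_trans h) // leeD2l //.
exact: ltW.
Qed.
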